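(* Let $X$ be a set and let $w:X\times X\to\mathbb{R}_{+}$ be a function, where $\mathbb{R}_+=[0,\infty)\cup\{\infty\}$. Then $(X,w)$ is a metric space (that is, $w$ is locally finite, reflexive, non-degenerate, symmetric, and satisfies the restricted triangle inequality) if and only if $w$ is locally finite, reflexive, non-degenerate, and satisfies the full triangle inequality.
   Context: For a function $w:X\times X\to\mathbb{R}_+$: it is locally finite if $w(x,y)\neq\infty$ for all $x,y$; non-degenerate if $w(x,y)=0$ implies $x=y$; reflexive if $w(x,x)=0$ for all $x$; symmetric if $w(x,y)=w(y,x)$ for all $x,y$. It satisfies the restricted triangle inequality if $w(x,z)\le w(x,y)+w(y,z)$ for all $x,y,z\in X$. It satisfies the full triangle inequality if $|w(x,y)-w(y,z)|\le w(x,z)\le w(x,y)+w(y,z)$ for all $x,y,z\in X$. Conventions: $x+\infty=\infty+x=\infty+\infty=\infty$, $|x-\infty|=|\infty-x|=\infty$ for real $x\ge 0$; if $w(x,y)=w(y,z)=\infty$ the full triangle inequality imposes no lower bound on $w(x,z)$. *)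

(* Defs.v *)
From HB Require Import structures.
From mathcomp Require Import all_boot all_order all_algebra.
From mathcomp Require Import interval_inference reals constructive_ereal.
Set Implicit Arguments.
Unset Strict Implicit.
Unset Printing Implicit Defensive.
Import Order.TTheory GRing.Theory Num.Theory.
Local Open Scope ring_scope.
Local Open Scope ereal_scope.

(* [{nonneg \bar R}] is [0, +oo) together with +oo, and [x%:num] is the
   underlying element of [\bar R]. *)
Section Distances.
Variables (R : realType) (X : Type).
Implicit Type w : X -> X -> {nonneg \bar R}.

Definition locally_finite w := forall x y, (w x y)%:num <> +oo.

Definition non_degenerate w := forall x y, (w x y)%:num = 0 -> x = y.

Definition w_reflexive w := forall x, (w x x)%:num = 0.

Definition w_symmetric w := forall x y, (w x y)%:num = (w y x)%:num.

Definition restricted_triangle w :=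
  forall x y z, (w x z)%:num <= (w x y)%:num + (w y z)%:num.

(* For a real r >= 0, [`|r%:E - +oo|] and [`|+oo - r%:E|] are +oo, as required.
   But [+oo - +oo] is -oo in [\bar R], whose absolute value is +oo, whereas no
   lower bound is imposed when both terms are infinite: hence the guard. *)
Definition full_triangle w :=
  forall x y z,
    (~ ((w x y)%:num = +oo /\ (w y z)%:num = +oo) ->
       `|(w x y)%:num - (w y z)%:num| <= (w x z)%:num) /\
    (w x z)%:num <= (w x y)%:num + (w y z)%:num.

Definition metric_space w :=
  [/\ locally_finite w, w_reflexive w, non_degenerate w, w_symmetric w
    & restricted_triangle w].

End Distances.

(* Main.v *)
Require Import Defs.
From HB Require Import structures.
From mathcomp Require Import all_boot all_order all_algebra.
From mathcomp Require Import interval_inference reals constructive_ereal.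
From mathcomp Require Import lra.
Set Implicit Arguments.
Unset Strict Implicit.
Unset Printing Implicit Defensive.
Import Order.TTheory GRing.Theory Num.Theory.
Local Open Scope ring_scope.
Local Open Scope ereal_scope.

(** By [locally_finite_EFin] all distances are real numbers, so the conventions on infinity never
    intervene. For a symmetric [w], the lower bound is the reverse triangle inequality. Conversely,
    that bound with [z = x] has right side [w x x], which is zero, and this forces symmetry. *)

Lemma locally_finite_EFin (R : realType) (X : Type)
    (w : X -> X -> {nonneg \bar R}) :
  locally_finite w ->
  exists d : X -> X -> R, forall x y, (w x y)%:num = (d x y)%:E.
Proof.
move=> wfin; exists (fun x y => fine (w x y)%:num) => x y.
rewrite fineK // ge0_fin_numE //.
by rewrite ltey; apply/eqP; exact: wfin.
Qed.

(* Symmetry is the full triangle inequality for the triple (x, y, x). *)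
Theorem corollary2p4 (R : realType) (X : Type) (w : X -> X -> {nonneg \bar R}) :
  metric_space w <->
  [/\ locally_finite w, w_reflexive w, non_degenerate w & full_triangle w].
Proof.
split=> [[wfin w0 wnd wsym wtri] | [wfin w0 wnd wfull]];
  have [d wE] := locally_finite_EFin wfin.
- split=> // x y z; split; last exact: wtri.
  (* After symmetry, these two instances bound [w x y - w y z] and its opposite by [w x z]. *)
  move=> _; move: (wtri x z y) (wtri y x z).
  rewrite (wsym z y) (wsym y x) !wE -!EFinD !lee_fin ler_norml => h1 h2.
  by apply/andP; split; lra.
- split=> // [x y | x y z]; last by case: (wfull x y z).
  have [+ _] := wfull x y x.
  (* Local finiteness discharges the guard on the lower bound. *)
  have fin_xy : ~ ((w x y)%:num = +oo /\ (w y x)%:num = +oo).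
    by case=> /wfin.
  move=> /(_ fin_xy).
  rewrite w0 !wE -EFinB lee_fin normr_le0 subr_eq0.
  by move=> /eqP ->.
Qed.
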